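(* Suppose that $f$ is bilipschitz on $T=\mathbb T_q$ with respect to $\rho$, i.e. $f$ is a map from $T$ onto itself and there is a constant $C$ such that $$e^{-C}\rho(f(x),f(y))\le\rho(x,y)\le e^{C}\rho(f(x),f(y))\qquad\text{for all }x,y\in T.$$ Then $f$ is a $(1,4C)$-quasi-isometric bijection with respect to $d$, namely $f$ is a bijection and $$d(f(x),f(y))-4C\le d(x,y)\le d(f(x),f(y))+4C\qquad\text{for all }x,y\in T.$$ In particular, every isometry with respect to $\rho$ is an isometry with respect to $d$.
   Context: $T=\mathbb T_q$ is (the vertex set of) the homogeneous tree of order $q+1$ ($q\ge1$ an integer): every vertex has exactly $q+1$ neighbours. $d$ is the geodesic distance. $\partial T$ is the boundary of $T$ (equivalence classes of semi-infinite geodesics, two being equivalent if they eventually coincide). Fix $\omega_*\in\partial T$; $[x,\omega_* )$ is the semi-infinite geodesic from $x$ to $\omega_*$, and $x\le y$ means $y\in[x,\omega_* )$. Fix $o\in T$, enumerate $[o,\omega_* )=\{x_j\}_{j\in\mathbb N}$ with $x_0=o$ and $d(x_j,x_k)=|j-k|$, and define the level $\ell(x)=\lim_{j\to\infty}(j-d(x,x_j))$. The confluent $x\wedge y$ of $x,y\in T$ is the vertex $z$ of minimum level with $x\le z$ and $y\le z$. The Gromov distance is $\rho(x,y)=e^{\ell(x\wedge y)}$ if $x\ne y$ and $\rho(x,x)=0$. *)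

(* Defs.v *)
From HB Require Import structures.
From mathcomp Require Import all_boot all_order all_algebra.
From mathcomp Require Import all_classical all_reals all_analysis.

Set Implicit Arguments.
Unset Strict Implicit.
Unset Printing Implicit Defensive.

Import Order.TTheory GRing.Theory Num.Theory.
Import numFieldNormedType.Exports.

Local Open Scope classical_set_scope.
Local Open Scope ring_scope.

Section Graph.
Variables (T : choiceType) (edge : rel T).

Record is_tree : Prop := IsTree {
  edge_sym : symmetric edge;
  edge_irr : irreflexive edge;
  tree_connected : forall x y : T, exists2 p : seq T, path edge x p & last x p = y;
  (* [:: x; y] with x, y adjacent is a [ucycle], hence the bound on the size *)
  tree_acyclic : forall c : seq T, (2 < size c)%N -> ~ ucycle edge c }.

Definition is_homogeneous_tree (q : nat) : Prop :=
  is_tree /\ forall x : T, ([set y | edge x y] #= `I_q.+1)%card.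

Definition walk_length (x y : T) : set nat :=
  [set n | exists p : seq T, [/\ path edge x p, last x p = y & size p = n]].

(* The default value 0 is only used when x and y are not connected. *)
Definition dist (x y : T) : nat :=
  xget 0%N [set n | walk_length x y n /\
                    forall m, walk_length x y m -> (n <= m)%N].

Definition geodesic_ray (g : nat -> T) : Prop :=
  forall i k : nat, dist (g i) (g (i + k)%N) = k.

(* Rays are parametrized from their origin, so that eventually coinciding
   allows for a shift of the parameter. *)
Definition ray_equiv (g h : nat -> T) : Prop :=
  exists m n : nat, forall k : nat, g (m + k)%N = h (n + k)%N.

Definition boundary : set (set (nat -> T)) :=
  [set omega | exists2 g, geodesic_ray g &
                 omega = [set h | geodesic_ray h /\ ray_equiv g h]].

Section Gromov.
Variables (R : realType) (omega : set (nat -> T)) (o : T).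

(* [x, omega): in a tree there is exactly one such ray, and the default value
   is never used. *)
Definition ray_to (x : T) : nat -> T :=
  xget (fun=> x) [set g | omega g /\ g 0%N = x].

Definition tree_le (x y : T) : Prop := range (ray_to x) y.

Definition level (x : T) : R :=
  limn (fun j : nat => j%:R - (dist x (ray_to o j))%:R : R).

(* In a tree there is exactly one such z. *)
Definition confluent (x y : T) : T :=
  xget x [set z | [/\ tree_le x z, tree_le y z &
    forall w, tree_le x w -> tree_le y w -> level z <= level w]].

Definition gromov_dist (x y : T) : R :=
  if x == y then 0 else expR (level (confluent x y)).

End Gromov.
End Graph.

Definition onto (T : Type) (f : T -> T) : Prop := set_surj [set: T] [set: T] f.

Definition bilipschitz (T : Type) (R : realType) (rho : T -> T -> R) (C : R)
    (f : T -> T) : Prop :=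
  onto f /\
  forall x y : T, expR (- C) * rho (f x) (f y) <= rho x y /\
                  rho x y <= expR C * rho (f x) (f y).

(* As for bilipschitz maps, isometries are maps of T onto itself. *)
Definition is_isometry (T V : Type) (delta : T -> T -> V) (f : T -> T) : Prop :=
  onto f /\ forall x y : T, delta (f x) (f y) = delta x y.

(* Main.v *)
Require Import Defs.
From HB Require Import structures.
From mathcomp Require Import all_boot all_order all_algebra.
From mathcomp Require Import all_classical all_reals all_analysis.
From mathcomp Require Import zify ring lra.

(** Every vertex [x] has a parent, its neighbour on the way to the fixed
    boundary point, and the parent map rules the whole geometry: [x] and [y]
    have a common ancestor [z], their confluent, reached from [x] in
    [l z - l x] steps and from [y] in [l z - l y] steps, and the geodesic from
    [x] to [y] goes up to [z] and down again.  Hence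
      [d x y = 2 * l (confluent x y) - l x - l y]
    ([dist_confluent]), so it suffices that a bilipschitz map [f] changes the
    level of a confluent, and the level of a vertex, by at most [C]: the
    distance then changes by at most [2 * C + C + C].

    For distinct points [ln (rho x y)] is the level of the confluent, so the
    bilipschitz condition is exactly the bound on levels of confluents
    ([bilipschitz_confluent]).  Levels of vertices are determined by [rho] as
    well: [l x] is the minimum of [l (confluent x y)] over [y <> x].  It is a
    lower bound because the confluent is an ancestor of [x]
    ([level_confluent]), and it is attained at a child of [x]
    ([confluent_child]); a child exists since [q >= 1] gives [x] a neighbour
    other than its parent ([exists_child]).  As [f] is a bijection, comparing
    these minima gives [bilipschitz_level].

    The combinatorial input is that simple paths in an acyclic graph are
    determined by their endpoints ([simple_path_unique]).  It implies that
    each vertex starts exactly one ray of the end ([ray_toP], [end_unique]),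
    and that of two adjacent vertices one is the parent of the other
    ([edge_parent]).  From the latter, any walk from [x] to [y] of length [k]
    yields a common ancestor at total height at most [k] above [x] and [y]
    ([walk_meet]), which computes distances ([dist_meet]) and then levels
    ([levelE]). *)

Set Implicit Arguments.
Unset Strict Implicit.
Unset Printing Implicit Defensive.

Import Order.TTheory GRing.Theory Num.Theory.
Import numFieldNormedType.Exports.

Local Open Scope classical_set_scope.
Local Open Scope ring_scope.


(** * Simple paths, distances and rays in a tree *)

Section Walks.
Variables (T : choiceType) (edge : rel T) (tree_edge : is_tree edge).

Lemma distP (x y : T) :
  walk_length edge x y (dist edge x y) /\
  forall m, walk_length edge x y m -> (dist edge x y <= m)%N.
Proof.
suff /(xgetPex 0%N) : exists n, [set n | walk_length edge x y n /\
  forall m, walk_length edge x y m -> (n <= m)%N] n by [].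
have [s xs sy] := tree_connected tree_edge x y.
have ex : exists n, `[< walk_length edge x y n >].
  by exists (size s); apply/asboolP; exists s.
case: (ex_minnP ex) => n /asboolP xyn n_min; exists n; split=> // m xym.
by apply: n_min; apply/asboolP.
Qed.

Lemma dist_le (x : T) (s : seq T) :
  path edge x s -> (dist edge x (last x s) <= size s)%N.
Proof. by move=> xs; apply: (distP _ _).2; exists s. Qed.

Lemma distxx (x : T) : dist edge x x = 0%N.
Proof. by apply/eqP; rewrite -leqn0 (@dist_le x [::]). Qed.

Lemma dist1_edge (x y : T) : dist edge x y = 1%N -> edge x y.
Proof.
move=> xy1; have [[s []]] := distP x y; rewrite xy1.
by case: s => [|z [|? ?]] //= /andP[xz _] <-.
Qed.

(** Two simple paths with the same endpoints cannot branch: two branches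
    leaving [x] and joining again would close a cycle through [x]. *)
Lemma simple_path_unique (x : T) (s t : seq T) :
  path edge x s -> uniq (x :: s) -> path edge x t -> uniq (x :: t) ->
  last x s = last x t -> s = t.
Proof.
elim: s t x => [|a s IHs] [|b t] x //.
- by move=> _ _ _ /andP[xbt _] /= xE; rewrite [in x \in _]xE mem_last in xbt.
- by move=> _ /andP[xas _] _ _ /= xE; rewrite -[in x \in _]xE mem_last in xas.
move=> /andP[xa as_] /andP[x_as uas] /andP[xb bt] /andP[x_bt ubt] /= st.
have [ab|ab] := eqVneq a b.
  by subst b; congr (_ :: _); apply: (IHs t a).
have bt' : path edge (last a s) (rev (belast b t)).
  rewrite st rev_path; apply: sub_path bt => u v.
  by rewrite (edge_sym tree_edge).
have ab_path : path edge a (s ++ rev (belast b t)) by rewrite cat_path; apply/andP.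
have last_b : last a (s ++ rev (belast b t)) = b.
  by rewrite last_cat st; case: (t) => //= c u; rewrite rev_cons last_rcons.
(* The detour from [a] to [b] through the common endpoint avoids [x], so that
   adding [x] to it closes a cycle. *)
case/shortenP: ab_path last_b => u au uu sub_u last_b.
have x_au : x \notin a :: u.
  apply: contra x_as; rewrite !inE => /orP[->//|/sub_u].
  rewrite mem_cat mem_rev => /orP[->|/mem_belast x_in]; first by rewrite orbT.
  by rewrite x_in in x_bt.
case: (tree_acyclic tree_edge (c := x :: a :: u)).
  by case: u last_b {au uu sub_u x_au} => //= ab'; rewrite ab' eqxx in ab.
apply/andP; split; last by rewrite cons_uniq x_au.
by rewrite /= rcons_path xa au last_b (edge_sym tree_edge).
Qed.

(** Removing the loops of a shortest walk leaves a simple path, which is the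
    only one there is. *)
Lemma dist_simple (x : T) (s : seq T) :
  path edge x s -> uniq (x :: s) -> dist edge x (last x s) = size s.
Proof.
move=> xs us; apply/eqP; rewrite eqn_leq dist_le //=.
have [t [+ + <-]] := (distP x (last x s)).1.
case/shortenP=> u xu uu sub_u u_last.
have -> : s = u by apply: (simple_path_unique (x := x)).
by apply: uniq_leq_size sub_u; case/andP: uu.
Qed.

(** The origin [g 0] is left out, so that [segment g n] can be the second
    argument of [path edge (g 0)]. *)
Definition segment (g : nat -> T) (n : nat) : seq T :=
  [seq g i | i <- iota 1 n].

Lemma last_segment (g : nat -> T) (n : nat) : last (g 0%N) (segment g n) = g n.
Proof.
case: n => // n.
by rewrite /segment -[n.+1]addn1 iotaD map_cat last_cat /= add1n addn1.
Qed.

Lemma segment_path (g : nat -> T) (n : nat) :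
  (forall i, edge (g i) (g i.+1)) -> path edge (g 0%N) (segment g n).
Proof.
move=> g_edge; elim: n => // n IHn.
rewrite /segment -[n.+1]addn1 iotaD map_cat cat_path IHn last_segment /=.
by rewrite g_edge.
Qed.

Lemma segment_uniq (g : nat -> T) (n : nat) :
  injective g -> uniq (g 0%N :: segment g n).
Proof. by move=> g_inj; have := iota_uniq 0 n.+1; rewrite -(map_inj_uniq g_inj). Qed.

(** In a tree, geodesics are the paths without repetition; this local form is
    the one that survives prepending a vertex to a ray. *)
Lemma geodesic_rayP (g : nat -> T) :
  geodesic_ray edge g <-> (forall i, edge (g i) (g i.+1)) /\ injective g.
Proof.
split=> [g_geo|[g_edge g_inj] i k].
  split=> [i|]; first by apply: dist1_edge; rewrite -addn1 g_geo.
  suff lt_neq i j : (i < j)%N -> g i <> g j.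
    move=> i j gij; case: (ltngtP i j) => // /lt_neq; first by move/(_ gij).
    by move/(_ (esym gij)).
  move=> ij gij; have := g_geo i (j - i)%N.
  by rewrite subnKC 1?ltnW // gij distxx => /esym/eqP; rewrite subn_eq0 leqNgt ij.
pose h j := g (i + j)%N.
have h_edge j : edge (h j) (h j.+1) by rewrite /h addnS.
have h_inj : injective h by move=> a b /g_inj /addnI.
have := dist_simple (segment_path k h_edge) (segment_uniq k h_inj).
by rewrite last_segment size_map size_iota /h addn0.
Qed.

End Walks.

(** * The parent map defined by a boundary point *)

Section Ends.
Variables (T : choiceType) (edge : rel T) (tree_edge : is_tree edge).
Variables (omega : set (nat -> T)) (end_omega : boundary edge omega).

Lemma end_ray (g : nat -> T) :
  omega g -> (forall i, edge (g i) (g i.+1)) /\ injective g.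
Proof. by case: end_omega => h _ -> [/(geodesic_rayP tree_edge)]. Qed.

Lemma end_equiv (g h : nat -> T) : omega g -> omega h -> ray_equiv g h.
Proof.
case: end_omega => r _ -> [_ [m [n rg]]] [_ [m' [n' rh]]].
exists (n + m')%N, (n' + m)%N => k.
by rewrite -!addnA -rg -rh !addnA [(m' + m)%N]addnC.
Qed.

Lemma end_closed (g h : nat -> T) (m n : nat) :
  omega g -> (forall i, edge (h i) (h i.+1)) -> injective h ->
  (forall k, g (m + k)%N = h (n + k)%N) -> omega h.
Proof.
case: end_omega => r _ -> [_ [a [b rg]]] h_edge h_inj gh.
split; first by apply/(geodesic_rayP tree_edge).
exists (a + m)%N, (n + b)%N => k.
by rewrite -!addnA rg -gh addnCA.
Qed.

(** Both rays reach a common vertex [g m = h n]; up to there they are the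
    same simple path, so [m = n], and they coincide afterwards. *)
Lemma end_unique (g h : nat -> T) :
  omega g -> omega h -> g 0%N = h 0%N -> g = h.
Proof.
move=> og oh gh0; have [m [n gh]] := end_equiv og oh.
have [[g_edge g_inj] [h_edge h_inj]] := (end_ray og, end_ray oh).
have seg_eq : segment g m = segment h n.
  apply: (simple_path_unique tree_edge (x := g 0%N)).
  - exact: segment_path.
  - exact: segment_uniq.
  - by rewrite gh0; apply: segment_path.
  - by rewrite gh0; apply: segment_uniq.
  - by rewrite last_segment gh0 last_segment -[m]addn0 gh addn0.
have mn : m = n by have /(congr1 size) := seg_eq; rewrite !size_map !size_iota.
apply/funext => i; case: (leqP m i) => [mi|im].
  by rewrite -(subnKC mi) gh mn.
case: i im => // i im.
have := congr1 (nth (g 0%N) ^~ i) seg_eq.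
by rewrite /segment -mn !(nth_map 0%N) ?size_iota 1?ltnW // nth_iota 1?ltnW.
Qed.

Lemma end_shift (g : nat -> T) : omega g -> omega (fun i => g i.+1).
Proof.
move=> og; have [g_edge g_inj] := end_ray og.
by apply: (end_closed (m := 1) (n := 0) og) => // i j /g_inj [].
Qed.

(** If [y] occurred on the ray, the edge from [g 0] to [y] and the beginning
    of the ray would be two simple paths, so [y] would be [g 1]. *)
Lemma end_cons (g : nat -> T) (y : T) :
  omega g -> edge y (g 0%N) -> y <> g 1%N ->
  omega (fun i => if i is j.+1 then g j else y).
Proof.
move=> og y_edge y_g1; have [g_edge g_inj] := end_ray og.
have y_g i : y <> g i.
  move=> ygi; have i1 : segment g i = [:: y].
    apply: (simple_path_unique tree_edge (x := g 0%N)).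
    - exact: segment_path.
    - exact: segment_uniq.
    - by rewrite /= (edge_sym tree_edge) y_edge.
    - rewrite /= inE andbT; apply/eqP => g0y.
      by rewrite g0y (edge_irr tree_edge) in y_edge.
    - by rewrite last_segment.
  have /(congr1 size) := i1; rewrite size_map size_iota /= => i1'.
  by rewrite i1' in ygi.
apply: (end_closed (m := 0) (n := 1) og) => //; first by case.
by case=> [|i] [|j] // => [/y_g|/esym /y_g|/g_inj ->].
Qed.

(** Rays of the end propagate along edges: a neighbour of the origin either is
    the second vertex of the ray, which is then shortened, or can be put in
    front of it. *)
Lemma ray_toP (x : T) : omega (ray_to omega x) /\ ray_to omega x 0%N = x.
Proof.
suff /(xgetPex (fun=> x)) : exists g, [set g | omega g /\ g 0%N = x] g by [].
have [g og] : exists g, omega g.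
  by case: end_omega => g g_geo ->; exists g; split=> //; exists 0%N, 0%N.
have [s] := tree_connected tree_edge (g 0%N) x.
elim: s g og => [|y s IHs] g og /=; first by exists g.
case/andP=> gy ys sx.
have [yg|/eqP yg] := eqVneq y (g 1%N).
  by apply: (IHs _ (end_shift og)); rewrite -yg.
rewrite (edge_sym tree_edge) in gy.
exact: (IHs _ (end_cons og gy yg)).
Qed.

Lemma ray_toE (x : T) (g : nat -> T) :
  omega g -> g 0%N = x -> ray_to omega x = g.
Proof.
by move=> og gx; have [ox rx] := ray_toP x; apply: end_unique; rewrite // rx.
Qed.

Definition parent (x : T) : T := ray_to omega x 1%N.

Lemma ray_to_iter (x : T) (n : nat) : ray_to omega x n = iter n parent x.
Proof.
elim: n x => [|n IHn] x; first by have [] := ray_toP x.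
rewrite iterSr -IHn (@ray_toE (parent x) (fun i => ray_to omega x i.+1)) //.
by have [/end_shift] := ray_toP x.
Qed.

Lemma tree_leP (x y : T) : tree_le omega x y <-> exists n, iter n parent x = y.
Proof.
by split=> [[n _ <-]|[n <-]]; exists n; rewrite // ray_to_iter.
Qed.

(** If [y] is not the parent of [x], then [y] followed by the ray from [x] is
    the ray from [y]. *)
Lemma edge_parent (x y : T) : edge x y -> y = parent x \/ x = parent y.
Proof.
move=> xy; have [ox x0] := ray_toP x.
have [->|/eqP yx] := eqVneq y (parent x); first by left.
rewrite (edge_sym tree_edge) -[in edge _ _]x0 in xy.
by right; rewrite /parent (ray_toE (end_cons ox xy yx)).
Qed.

Lemma iter_parent_inj (x : T) : injective (fun n => iter n parent x).
Proof.
have [_ r_inj] := end_ray (ray_toP x).1.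
by move=> m n /=; rewrite -!ray_to_iter => /r_inj.
Qed.

Lemma iter_parent_meet (x y : T) :
  exists m n, iter m parent x = iter n parent y.
Proof.
have [m [n mn]] := end_equiv (ray_toP x).1 (ray_toP y).1.
by exists m, n; rewrite -!ray_to_iter; have := mn 0%N; rewrite !addn0.
Qed.

(** The difference of the heights at which the ancestors of [x] and of [y]
    meet does not depend on the meeting point. *)
Lemma meet_shift (x y : T) (m n m' n' : nat) :
  iter m parent x = iter n parent y -> iter m' parent x = iter n' parent y ->
  (m + n' = m' + n)%N.
Proof.
move=> mn mn'; apply: (@iter_parent_inj y).
by rewrite /= iterD -mn' -iterD addnC iterD mn -iterD.
Qed.

Lemma iter_parent_path (x : T) (n : nat) :
  exists2 s, path edge x s & last x s = iter n parent x /\ size s = n.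
Proof.
exists (segment (ray_to omega x) n); last first.
  have [_ {1}<-] := ray_toP x.
  by rewrite last_segment ray_to_iter size_map size_iota.
have [ox {1}<-] := ray_toP x.
by apply: segment_path; have [] := end_ray ox.
Qed.

(** A step of a walk either climbs to the parent or descends to a child, by
    [edge_parent]; each shifts the heights of a common ancestor by one. *)
Lemma walk_meet (x : T) (s : seq T) : path edge x s ->
  exists m n, iter m parent x = iter n parent (last x s) /\ (m + n <= size s)%N.
Proof.
elim: s x => [|y s IHs] x /=; first by exists 0%N, 0%N.
case/andP=> /edge_parent xy /IHs[m [n [mn mn_s]]].
case: xy => [yx|xy]; first by exists m.+1, n; rewrite iterSr -yx.
(* The walk starts with a descent from [x] to [y].  If the ancestor met is [y]
   itself, [x] is used instead, one level higher. *)
case: m mn mn_s => [|m] mn mn_s.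
  by exists 0%N, n.+1; rewrite /= -mn -xy addnS.
exists m, n; rewrite xy -iterSr; split=> //.
by rewrite ltnW // ltnS ltnW // -addSn.
Qed.

Lemma dist_meet (x y : T) (m n : nat) :
  iter m parent x = iter n parent y ->
  (forall m' n', iter m' parent x = iter n' parent y -> (m + n <= m' + n')%N) ->
  dist edge x y = (m + n)%N.
Proof.
move=> mn mn_min; have [[s [xs sy s_dist]] dist_min] := distP tree_edge x y.
apply/eqP; rewrite eqn_leq; apply/andP; split; last first.
  have [m' [n' [mn' le_s]]] := walk_meet xs; rewrite -s_dist.
  by apply: leq_trans le_s; apply: mn_min; rewrite mn' sy.
apply: dist_min.
have [t xt [t_last <-]] := iter_parent_path x m.
have [u yu [u_last <-]] := iter_parent_path y n.
exists (t ++ rev (belast y u)); split.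
- rewrite cat_path xt t_last mn -u_last rev_path; apply: sub_path yu => a b.
  by rewrite (edge_sym tree_edge).
- rewrite last_cat t_last mn -u_last; case: (u) => //= c v.
  by rewrite rev_cons last_rcons.
- by rewrite size_cat size_rev size_belast.
Qed.

(** * Levels and confluents *)

Section Level.
Variables (R : realType) (o : T).

Local Notation level := (level edge R omega o).
Local Notation confluent := (confluent edge R omega o).

(** From [j = n] on, the ray from [o] is above the meeting point, where
    [j - d(x, x_j)] is constant. *)
Lemma levelE (x : T) (m n : nat) :
  iter m parent x = iter n parent o -> level x = n%:R - m%:R.
Proof.
move=> mn; apply: lim_near_cst; first exact: norm_hausdorff.
exists n => // j /= nj; rewrite ray_to_iter.
rewrite (@dist_meet _ _ (m + (j - n)) 0).
- by rewrite addn0 natrD natrB //; ring.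
- by rewrite addnC iterD mn -iterD subnK.
move=> m' n'; rewrite -iterD => mn'.
have := meet_shift mn mn'; lia.
Qed.

Lemma level_iter (x : T) (k : nat) : level (iter k parent x) = level x + k%:R.
Proof.
have [m [n mn]] := iter_parent_meet x o.
rewrite (levelE mn) (@levelE _ m (k + n)) ?natrD; first by ring.
by rewrite -iterD addnC !iterD mn.
Qed.

(** Among common ancestors the level and the two heights differ by the same
    amount, so the one of minimum level also minimizes the sum of the heights,
    which is the distance by [dist_meet]. *)
Lemma confluentP (x y : T) : exists m n,
  [/\ confluent x y = iter m parent x, confluent x y = iter n parent y &
      dist edge x y = (m + n)%N].
Proof.

pose meets m := `[< exists n, iter m parent x = iter n parent y >].
have ex_m : exists m, meets m.
  by have [m mn] := iter_parent_meet x y; exists m; apply/asboolP.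
case: (ex_minnP ex_m) => m /asboolP[n mn] m_min.
have m_le m' n' : iter m' parent x = iter n' parent y -> (m <= m')%N.
  by move=> mn'; apply: m_min; apply/asboolP; exists n'.
suff /(xgetPex x) : exists z, [set z | [/\ tree_le omega x z, tree_le omega y z &
    forall w, tree_le omega x w -> tree_le omega y w -> level z <= level w]] z.
  rewrite -/(confluent x y) => -[/tree_leP[a xa] /tree_leP[b yb] z_min].
  exists a, b; split=> //; apply: dist_meet => [|a' b' ab']; first by rewrite xa.
  have := meet_shift (etrans xa (esym yb)) ab'.
  have : level (confluent x y) <= level (iter a' parent x).
    by apply: z_min; apply/tree_leP; [exists a'|exists b'].
  by rewrite -xa !level_iter lerD2l ler_nat; lia.
exists (iter m parent x); split; first by apply/tree_leP; exists m.
  by apply/tree_leP; exists n.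
move=> w /tree_leP[m' xw] /tree_leP[n' yw].
by rewrite -xw !level_iter lerD2l ler_nat (m_le _ n') // xw yw.
Qed.

Lemma dist_confluent (x y : T) :
  (dist edge x y)%:R = 2 * level (confluent x y) - level x - level y.
Proof.
have [m [n [xz yz ->]]] := confluentP x y.
have zx : level (confluent x y) = level x + m%:R by rewrite xz level_iter.
have zy : level (confluent x y) = level y + n%:R by rewrite yz level_iter.
by rewrite natrD; lra.
Qed.

Lemma level_confluent (x y : T) : level x <= level (confluent x y).
Proof.
by have [m [_ [-> _ _]]] := confluentP x y; rewrite level_iter lerDl.
Qed.

Lemma confluent_child (x : T) :
  level (confluent (parent x) x) = level (parent x).
Proof.
have lp : level (parent x) = level x + 1 by rewrite (level_iter x 1).
have d1 : dist edge (parent x) x = 1%N.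
  rewrite (@dist_meet _ _ 0 1) // => m' n' mn'.
  have := @meet_shift (parent x) x 0 1 m' n' erefl mn'; lia.
by have := dist_confluent (parent x) x; rewrite d1 lp; lra.
Qed.

Lemma gromov_distE (x y : T) : x <> y ->
  gromov_dist edge R omega o x y = expR (level (confluent x y)).
Proof. by rewrite /gromov_dist; case: eqP. Qed.

End Level.

(** [x] has at least two neighbours, and those other than its parent are its
    children. *)
Lemma exists_child (q : nat) : (1 <= q)%N ->
  (forall x : T, ([set y | edge x y] #= `I_q.+1)%card) ->
  forall x, exists2 y, parent y = x & x <> y.
Proof.
move=> q1 deg x.
have [y xy y_x] : exists2 y, edge x y & y <> parent x.
  have /card_set_bijP[h [h_to h_inj h_surj]] := deg x.
  have [y xy hy] := h_surj 0%N isT.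
  have [z xz hz] := h_surj 1%N q1.
  have [y_x|/eqP ?] := eqVneq y (parent x); last by exists y.
  by exists z => // z_x; rewrite z_x -y_x hy in hz.
exists y; first by case: (edge_parent xy).
by move=> x_y; rewrite x_y /= (edge_irr tree_edge) in xy.
Qed.

(** * Bilipschitz maps for the Gromov distance *)

Section Bilipschitz.
Variables (R : realType) (o : T) (C : R) (f : T -> T).
Hypothesis child : forall x, exists2 y, parent y = x & x <> y.
Hypothesis bilip : bilipschitz (gromov_dist edge R omega o) C f.

Local Notation level := (level edge R omega o).
Local Notation confluent := (confluent edge R omega o).

Lemma bilipschitz_inj : injective f.
Proof.
move=> x y fxy; apply/eqP/contraT => /eqP xy.
have [_] := bilip.2 x y.
by rewrite gromov_distE // /gromov_dist fxy eqxx mulr0 leNgt expR_gt0.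
Qed.

Lemma bilipschitz_confluent (x y : T) : x <> y ->
  `|level (confluent (f x) (f y)) - level (confluent x y)| <= C.
Proof.
move=> xy; have fxy : f x <> f y by move/bilipschitz_inj.
have := bilip.2 x y; rewrite !gromov_distE // -!expRD !ler_expR ler_norml.
by case=> ? ?; apply/andP; split; lra.
Qed.

(** The minimum of [level (confluent x y)] over [y <> x] is [level x], attained
    at the children of [x]; surjectivity of [f] provides a preimage of a child
    of [f x] for the second inequality. *)
Lemma bilipschitz_level (x : T) : `|level (f x) - level x| <= C.
Proof.
have upper : level (f x) <= level x + C.
  have [y yx xy] := child x.
  have := bilipschitz_confluent xy; rewrite ler_norml => /andP[_].
  have := confluent_child R o y; rewrite yx => ->.
  have := level_confluent R o (f x) (f y); lra.
have lower : level x <= level (f x) + C.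
  have [z zx xz] := child (f x); have [y _ yz] := bilip.1 z I; subst z.
  have xy : x <> y by move=> xy; rewrite xy in xz.
  have := bilipschitz_confluent xy; rewrite ler_norml => /andP[+ _].
  have := confluent_child R o (f y); rewrite zx => ->.
  have := level_confluent R o x y; lra.
by rewrite ler_norml; apply/andP; split; lra.
Qed.

Lemma bilipschitz_dist (x y : T) :
  `|(dist edge (f x) (f y))%:R - (dist edge x y)%:R| <= 4 * C.
Proof.
have := bilipschitz_level x; have := bilipschitz_level y.
have [->|/eqP xy] := eqVneq x y.
  (* The bound on levels forces [0 <= C]. *)
  move=> _; rewrite !(distxx tree_edge) subrr normr0.
  by have := normr_ge0 (level (f y) - level y); lra.
have := bilipschitz_confluent xy.
rewrite !(dist_confluent R o) !ler_norml => /andP[? ?] /andP[? ?] /andP[? ?].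
by apply/andP; split; lra.
Qed.

Lemma bilipschitz_bij : bijective f.
Proof.
rewrite -setTT_bijective; split=> [//| |]; last exact: bilip.1.
exact: in2W bilipschitz_inj.
Qed.

End Bilipschitz.
End Ends.

Theorem proposition4p4 (R : realType) (q : nat) (hq : (1 <= q)%N)
    (T : choiceType) (edge : rel T) (hT : is_homogeneous_tree edge q)
    (omega : set (nat -> T)) (homega : boundary edge omega) (o : T) :
  (forall (C : R) (f : T -> T),
      bilipschitz (gromov_dist edge R omega o) C f ->
      bijective f /\
      forall x y : T,
        (dist edge (f x) (f y))%:R - 4 * C <= (dist edge x y)%:R /\
        (dist edge x y)%:R <= (dist edge (f x) (f y))%:R + 4 * C) /\
  (forall g : T -> T,
      is_isometry (gromov_dist edge R omega o) g -> is_isometry (dist edge) g).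
Proof.
have [tree_edge deg] := hT.
have child := exists_child tree_edge homega hq deg.
split=> [C f bilip|g [g_onto g_iso]].
  split=> [|x y]; first exact: bilipschitz_bij bilip.
  have := bilipschitz_dist tree_edge homega child bilip x y.
  by rewrite ler_norml => /andP[? ?]; split; lra.
have bilip : bilipschitz (gromov_dist edge R omega o) 0 g.
  by split=> // x y; rewrite oppr0 expR0 !mul1r g_iso.
split=> // x y; apply/eqP; rewrite -(eqr_nat R) -subr_eq0 -normr_le0.
by have := bilipschitz_dist tree_edge homega child bilip x y; rewrite mulr0.
Qed.
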